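(* For every constant $c>0$ there is a constant $C>0$ such that the following holds. Let $\mathcal{G}=(G_1,\dots,G_T)$ be an always-connected temporal graph on $n$ vertices whose underlying graph $U$ has a $c$-strict $(r,b)$-division, with $r\ge 2$ and $b\ge 1$, and let $\Delta$ be the average degree of $U$. Put \[ f=n r^{0.5}b^{3}\Delta^{1.5}\log^{1.5}(r)+n^{2}/r, \] and suppose $T\ge Cf$. Then $b$ agents, starting at arbitrary given vertices, can visit all vertices of $\mathcal{G}$ using only the snapshots $G_1,\dots,G_{\lceil Cf\rceil}$.
   Context: A temporal graph $\mathcal{G}=(G_1,\dots,G_T)$ on a vertex set $V$, $|V|=n$, is a sequence of simple undirected graphs $G_t=(V,E_t)$. It is always-connected if each $G_t$ is connected. Its underlying graph is $U=(V,\bigcup_tE_t)$, with average degree $\Delta=\frac1n\sum_v\deg_U(v)$. A set $S\subseteq V$ is an $(r,b)$-division of a graph $G=(V,E)$ if $V\setminus S$ can be partitioned into parts (components) $C_1,\dots,C_q$ such that: - every edge of $G$ either lies inside one part, or lies inside $S$, or joins a part to $S$; - each part has at most $r$ vertices; - each part has at most $b$ vertices of $S$ adjacent to it (its boundary vertices). The division is $c$-strict if $q\le c\,n/r$; the paper calls this ''strict'', meaning there are $O(n/r)$ components. A temporal walk is a sequence $((v_0,v_1),t_1),\dots,((v_{\ell-1},v_\ell),t_\ell)$ with $\{v_{j-1},v_j\}\in E_{t_j}$ and $t_1<\dots<t_\ell$. Waiting is allowed, and the walk visits $v_0,\dots,v_\ell$. Each agent follows one temporal walk from its start vertex. *)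

(* Defs.v *)
From HB Require Import structures.
From mathcomp Require Import all_boot all_order all_algebra.
From mathcomp Require Import all_classical all_reals all_analysis.

Set Implicit Arguments.
Unset Strict Implicit.
Unset Printing Implicit Defensive.

Import Order.TTheory GRing.Theory Num.Theory.

Local Open Scope ring_scope.

Record sgraph (V : finType) := SGraph {
  adj : rel V;
  adj_sym : symmetric adj;
  adj_irrefl : irreflexive adj }.

Definition connected_graph (V : finType) (G : sgraph V) : Prop :=
  forall x y : V, connect (adj G) x y.

Definition degree (V : finType) (G : sgraph V) (v : V) : nat :=
  #|[set w : V | adj G v w]|.

Definition average_degree (R : realType) (V : finType) (G : sgraph V) : R :=
  (\sum_(v : V) degree G v)%N%:R / #|V|%:R.

(* The snapshot G_t, for 1 <= t <= T, is the value at the ordinal t - 1. *)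
Definition tgraph (V : finType) (T : nat) := 'I_T -> sgraph V.

Definition always_connected (V : finType) (T : nat) (G : tgraph V T) : Prop :=
  forall t : 'I_T, connected_graph (G t).

Section Underlying.
Variables (V : finType) (T : nat) (G : tgraph V T).

Definition underlying_adj : rel V :=
  fun x y => [exists t : 'I_T, adj (G t) x y].

Lemma underlying_sym : symmetric underlying_adj.
Proof. by move=> x y; apply: eq_existsb => t; rewrite adj_sym. Qed.

Lemma underlying_irrefl : irreflexive underlying_adj.
Proof. by move=> x; apply/existsP => -[t]; rewrite adj_irrefl. Qed.

Definition underlying : sgraph V := SGraph underlying_sym underlying_irrefl.

End Underlying.

Definition boundary (V : finType) (G : sgraph V) (S C : {set V}) : {set V} :=
  [set s in S | [exists x in C, adj G x s]].

(* P is the set of parts; [finset.partition] makes the parts nonempty, pairwise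
   disjoint, and with union V \ S. They need not be connected in G. *)
Definition division_parts (V : finType) (G : sgraph V) (r b : nat)
    (S : {set V}) (P : {set {set V}}) : Prop :=
  [/\ finset.partition P (~: S),
      forall x y : V, adj G x y ->
        [\/ exists2 C, C \in P & (x \in C) && (y \in C),
            (x \in S) && (y \in S) |
            exists2 C, C \in P &
              (x \in C) && (y \in S) || (x \in S) && (y \in C)],
      forall C, C \in P -> (#|C| <= r)%N
    & forall C, C \in P -> (#|boundary G S C| <= b)%N].

Definition strict_division (R : realType) (c : R) (V : finType) (G : sgraph V)
    (r b : nat) (S : {set V}) : Prop :=
  exists2 P : {set {set V}}, division_parts G r b S P
    & #|P|%:R <= c * #|V|%:R / r%:R.

(* The step ((u, v), t) traverses the edge {u, v} of the snapshot at t. *)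
Definition tstep (V : finType) (T : nat) : Type := ((V * V) * 'I_T)%type.

Definition temporal_walk (V : finType) (T : nat) (G : tgraph V T) (v0 : V)
    (w : seq (tstep V T)) : bool :=
  [&& all (fun s : tstep V T => adj (G s.2) s.1.1 s.1.2) w,
      sorted (fun s s' : tstep V T => (s.1.2 == s'.1.1) && (s.2 < s'.2)%N) w
    & head v0 [seq s.1.1 | s <- w] == v0].

Definition visited (V : finType) (T : nat) (v0 : V) (w : seq (tstep V T)) :
    seq V := v0 :: [seq s.1.2 | s <- w].

(* The b agents, agent i starting at [start i], visit all vertices using only
   the first k snapshots; the step index t : 'I_T refers to snapshot t + 1. *)
Definition explorable_within (V : finType) (T : nat) (G : tgraph V T)
    (b : nat) (start : 'I_b -> V) (k : int) : Prop :=
  exists w : 'I_b -> seq (tstep V T),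
    [/\ forall i, temporal_walk G (start i) (w i),
        forall i (s : tstep V T), s \in w i -> Posz (nat_of_ord s.2).+1 <= k
      & forall v : V, exists i, v \in visited (start i) (w i)].

(* The base of the logarithm only affects the multiplicative constant. *)
Definition exploration_bound (R : realType) (n r b : nat) (Delta : R) : R :=
  n%:R * (r%:R `^ (1 / 2)) * b%:R ^+ 3 * (Delta `^ (3 / 2))
    * ((ln r%:R) `^ (3 / 2)) + n%:R ^+ 2 / r%:R.

(* Main.v *)
Require Import Defs.
From HB Require Import structures.
From mathcomp Require Import all_boot all_order all_algebra.
From mathcomp Require Import all_classical all_reals all_analysis.
From mathcomp Require Import fintype finset boolp zify ring lra.

Set Implicit Arguments.
Unset Strict Implicit.
Unset Printing Implicit Defensive.

Import Order.TTheory GRing.Theory Num.Theory.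

(** Any always-connected temporal graph, with n vertices and degree sum E = n Delta,
    can be explored by one agent in O(n^(4/3) Delta^(2/3)) steps, and weighted AM-GM
    bounds this by a constant times f, whatever r is.

    Counting argument ([indep_bound]): let [g] be a potential on vertices that never
    increases along temporal walks, and let Y be a set of vertices on which [g] is
    constant during a window of l steps and which do not reach each other at equal
    potential. Every u in Y uses an edge of the snapshot at each step, and these edges
    are essentially distinct, so |Y| l is at most about twice E plus the weighted drop
    of [g] over the window.

    Take as [g] the number of rounds in which a walk can still collect h new vertices
    of the unvisited set X against an opponent who blocks h^2 vertices in each round.
    If [g] were below h everywhere, it would be constant on half of X during some
    window of length about h^2 E / |X|; the counting argument, applied in the two parts
    of the window, then yields walks at constant level that the opponent cannot all
    block, a contradiction. Hence about h^3 E / |X| steps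
    suffice to visit h^2 vertices of X. Choosing this number of steps to be n and
    repeating the phase until X is empty gives the bound. *)

(** * Trajectories with waiting, temporal reachability, monotone potentials *)

Section Trajectories.
Variables (V : finType) (A : nat -> rel V).

Definition traj (s t : nat) (p : nat -> V) : Prop :=
  forall i, s <= i < t -> p i = p i.+1 \/ A i (p i) (p i.+1).

Definition reach (s : nat) (u : V) (t : nat) (w : V) : Prop :=
  s <= t /\ exists p, [/\ traj s t p, p s = u & p t = w].

Definition vis (p : nat -> V) (s t : nat) : {set V} :=
  [set p (nat_of_ord i) | i : 'I_t.+1 & s <= i].

Definition tcat (t : nat) (p p' : nat -> V) : nat -> V :=
  fun i => if i <= t then p i else p' i.

Lemma visP p s t a :
  reflect (exists2 i, s <= i <= t & p i = a) (a \in vis p s t).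
Proof.
apply: (iffP imsetP) => [[i]|[i /andP[si it] <-]].
  by rewrite inE => si ->; exists i => //; rewrite si -ltnS ltn_ord.
by exists (Ordinal (n := t.+1) (m := i) it); rewrite ?inE.
Qed.

Lemma traj_cat s t r p p' : traj s t p -> traj t r p' -> p t = p' t ->
  traj s r (tcat t p p').
Proof.
move=> hp hp' e i /andP[si ir]; rewrite /tcat.
case: (ltngtP i t) => it; first by apply: hp; rewrite si.
  by apply: hp'; rewrite (ltnW it).
by rewrite it e; apply: hp'; rewrite leqnn -it.
Qed.

Lemma tcat_l t p p' i : i <= t -> tcat t p p' i = p i.
Proof. by rewrite /tcat => ->. Qed.

Lemma tcat_r t p p' i : p t = p' t -> t <= i -> tcat t p p' i = p' i.
Proof.
by rewrite /tcat => e ti; case: leqP => // it; have -> : i = t by lia.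
Qed.

Lemma vis_catl s t r p p' : t <= r -> vis p s t \subset vis (tcat t p p') s r.
Proof.
move=> tr; apply/subsetP=> a /visP[i /andP[si it] <-]; apply/visP; exists i.
  by rewrite si (leq_trans it).
exact: tcat_l.
Qed.

Lemma vis_catr s t r p p' : s <= t -> p t = p' t ->
  vis p' t r \subset vis (tcat t p p') s r.
Proof.
move=> st e; apply/subsetP=> a /visP[i /andP[ti ir] <-]; apply/visP; exists i.
  by rewrite ir (leq_trans st).
exact: tcat_r.
Qed.

Lemma reach_wait s t u : s <= t -> reach s u t u.
Proof. by split=> //; exists (fun=> u); split=> // i _; left. Qed.

Lemma reach_step t u w : A t u w -> reach t u t.+1 w.
Proof.
move=> uw; split=> //; exists (fun i => if i <= t then u else w).
split=> [i ti||]; rewrite ?leqnn ?ltnn //.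
have -> : i = t by lia.
by rewrite leqnn ltnn; right.
Qed.

Lemma reach_trans t v s u r w : reach s u t v -> reach t v r w -> reach s u r w.
Proof.
move=> [st [p [hp pu pv]]] [tr [p' [hp' pv' pw]]]; split; first exact: leq_trans tr.
have e : p t = p' t by rewrite pv pv'.
exists (tcat t p p'); split; first exact: traj_cat hp hp' e.
  by rewrite tcat_l.
by rewrite tcat_r.
Qed.

Lemma reach_traj s t p : s <= t -> traj s t p -> reach s (p s) t (p t).
Proof. by move=> st hp; split=> //; exists p. Qed.

Definition tmono (g : nat -> V -> nat) : Prop :=
  forall t v w, v = w \/ A t v w -> g t.+1 w <= g t v.

Lemma tmono_reach g s u t w : tmono g -> reach s u t w -> g t w <= g s u.
Proof.
move=> mg [st [p [hp <- <-]]].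
elim: t st hp => [|t IH] st hp.
  by have -> : s = 0 by lia.
move: st; rewrite leq_eqVlt => /orP[/eqP->//|st].
apply: leq_trans (IH st _); first by apply/mg/hp; rewrite leqnn -ltnS st.
by move=> i /andP[si it]; apply: hp; rewrite si leqW.
Qed.

Lemma tmono_wait g s t v : tmono g -> s <= t -> g t v <= g s v.
Proof. by move=> mg st; apply: tmono_reach mg (reach_wait _ st). Qed.

End Trajectories.

(** * Edge counting and independent sets *)

Lemma connect_cross (V : finType) (r : rel V) (K : {set V}) x y :
  connect r x y -> x \in K -> y \notin K ->
  exists k w, [/\ k \in K, w \notin K & r k w].
Proof.
case/connectP=> p; elim: p x => [|z p IH] x /= => [_ -> -> //|/andP[xz hp] ly xK yK].
case: (boolP (z \in K)) => [zK|zK]; first exact: IH zK yK.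
by exists x, z.
Qed.

Lemma card_ord_itv B a b : #|[set r : 'I_B | a <= r <= b]| <= (b - a).+1.
Proof.
have inj : {in [set r : 'I_B | a <= r <= b] &,
    injective (fun r : 'I_B => inord (r - a) : 'I_(b - a).+1)}.
  move=> r1 r2; rewrite !inE => h1 h2 /(congr1 val) /=.
  rewrite !inordK; [|lia|lia] => h; apply: val_inj => /=; lia.
rewrite -(card_in_imset inj); apply: leq_trans (max_card _) _.
by rewrite card_ord.
Qed.

Section Core.
Variables (V : finType) (A : nat -> rel V) (e : rel V).
Hypothesis A_sym : forall t, symmetric (A t).
Hypothesis A_conn : forall t x y, connect (A t) x y.
Hypothesis A_sub : forall t x y, A t x y -> e x y.

Let deg (w : V) : nat := #|[set k | e w k]|.

(* For u in Y and a time t, the vertices reached from u from which u can still be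
   reached form a proper subset of V, so an edge k w of the snapshot leaves it.
   The pair (u, t) is recovered from this edge, the value g u, and whether w had
   been reached from u before; moreover g u lies between the extreme values of g at w. *)
Lemma indep_bound (g : nat -> V -> nat) (s l : nat) (Y : {set V}) :
  tmono A g -> 1 < #|Y| ->
  {in Y, forall u, g (s + l) u = g s u} ->
  {in Y &, forall u u', u != u' -> g s u = g s u' -> ~ reach A s u (s + l) u'} ->
  #|Y| * l <= 2 * \sum_(w : V) deg w * (g s w - g (s + l) w).+1.
Proof.
move=> mg Y2 gY indep; set f := s + l.
pose good (d : V * 'I_l) (kw : V * V) := d.1 \in Y ->
  [/\ A (s + d.2) kw.1 kw.2, reach A s d.1 (s + d.2) kw.1,
      reach A (s + d.2).+1 kw.1 f d.1 &
      ~ (reach A s d.1 (s + d.2) kw.2 /\ reach A (s + d.2).+1 kw.2 f d.1)].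
have /choice[code codeP] : forall d, exists kw, good d kw.
  move=> [u i]; rewrite /good /=; set t := s + i.
  have tf : t < f by rewrite /t /f ltn_add2l.
  case: (boolP (u \in Y)) => uY; last by exists (u, u).
  pose K := [set w | `[< reach A s u t w /\ reach A t.+1 w f u >]].
  have uK : u \in K.
    by rewrite inE; apply/asboolP; split; apply: reach_wait; rewrite ?leq_addr.
  (* Any other vertex [u'] of [Y] lies outside [K]: walks from [u] to [u'] and from [u'] to [u]
     would force equal potentials, against independence. *)
  have [y yK] : exists y, y \notin K.
    have [u' u'Y] : exists2 u', u' \in Y & u' != u.
      have: 0 < #|Y :\ u| by rewrite (cardsD1 u Y) uY in Y2; lia.
      by case/card_gt0P=> u'; rewrite !inE => /andP[? ?]; exists u'.
    move=> nu; exists u'; rewrite inE; apply/asboolP => -[r1 r2].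
    have r1' : reach A s u f u' by apply: reach_trans r1 (reach_wait _ _ (ltnW tf)).
    have r2' : reach A s u' f u.
      by apply: reach_trans r2; apply: reach_wait; rewrite leqW ?leq_addr.
    apply: (indep u u') => //; first by rewrite eq_sym.
    have := tmono_reach mg r1'; have := tmono_reach mg r2'.
    by rewrite !gY // => h1 h2; apply/eqP; rewrite eqn_leq h1 h2.
  have [k [w [kK wK kw]]] := connect_cross (A_conn t u y) uK yK.
  exists (k, w) => _ /=; move: kK wK; rewrite !inE.
  by move=> /asboolP[? ?] /asboolP.
pose D := [set d : V * 'I_l | d.1 \in Y].
have cardD : #|D| = #|Y| * l.
  have -> : D = setX Y setT by apply/setP=> -[u i]; rewrite !inE /= andbT.
  by rewrite cardsX cardsT card_ord.
pose B := (\max_w g s w).+1.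
rewrite -cardD -sum1_card (partition_big (fun d => (code d).2) xpredT) //=.
rewrite big_distrr /=; apply: leq_sum => w _; rewrite sum1dep_card.
pose T := setX (setX [set: bool] [set k | e w k])
            [set r : 'I_B | g f w <= r <= g s w].
apply: (@leq_trans #|T|); last first.
  rewrite !cardsX cardsT card_bool -mulnA.
  by do 2![apply: leq_mul => //]; apply: card_ord_itv.
pose c (d : V * 'I_l) : bool * V * 'I_B :=
  (`[< reach A s d.1 (s + d.2) w >], (code d).1, inord (g s d.1)).
have gB u : g s u < B by apply: (leq_bigmax (F := g s)).
have cK d : val (c d).2 = g s d.1 by rewrite /= inordK.
set Dw := [set d | _].
have facts d : d \in Dw -> [/\ d.1 \in Y, A (s + d.2) (code d).1 w,
    reach A s d.1 (s + d.2) (code d).1, reach A (s + d.2).+1 (code d).1 f d.1 &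
      ~ (reach A s d.1 (s + d.2) w /\ reach A (s + d.2).+1 w f d.1)].
  by rewrite !inE => /andP[dY /eqP <-]; have [] := codeP d dY.
have lt (d : 'I_l) : s + d < f by rewrite /f ltn_add2l.
rewrite -(@card_in_imset _ _ c).
  apply/subset_leq_card/subsetP => _ /imsetP[d /facts[dY kw r1 r2 _] ->].
  rewrite !inE /= inordK // (A_sub (t := s + d.2)) 1?A_sym //=.
  apply/andP; split.
    apply: (tmono_reach mg); apply: (reach_trans r1).
    by apply: (reach_trans (reach_step kw)); apply: reach_wait; apply: lt.
  rewrite -(gY _ dY); apply: (tmono_reach mg).
  apply: (reach_trans _ (reach_trans (reach_step (_ : A (s + d.2) w _)) r2)).
    by apply: reach_wait; rewrite leq_addr.
  by rewrite A_sym.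
(* Equal potential and a common tail give a walk from [u] to [u'], hence [u = u']. If [i < i'], the
   bit at [i'] is true, hence so is the bit at [i], and [w] can return to [u] through the later use
   of the edge, against the choice of the edge at [i]. *)
have key d d' : d \in Dw -> d' \in Dw -> c d = c d' -> d.2 <= d'.2 -> d = d'.
  case: d d' => [u i] [u' i'] dD dD' cc /= ii'.
  have [uY kw r1 r2 nr] := facts _ dD; have [uY' kw' r1' r2' nr'] := facts _ dD'.
  move: cc; rewrite /c => -[/= cb ck cr].
  have gg : g s u = g s u' by move/(congr1 val): cr; rewrite /= !inordK.
  have uu : u = u'.
    apply/eqP/negPn/negP => nuu; apply: (indep u u') => //.
    apply: (reach_trans r1); rewrite /= ck; apply: (reach_trans _ r2') => /=.
    by apply: reach_wait; rewrite leqW // leq_add2l.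
  subst u'; congr (_, _); apply: val_inj; apply/eqP; rewrite eqn_leq ii' /= leqNgt.
  apply/negP => lt_ii'.
  have rA : `[< reach A s u (s + i) w >].
    rewrite cb; apply/asboolP; apply: (reach_trans r1); apply: (reach_trans (reach_step kw)).
    by apply: reach_wait; rewrite /= ltn_add2l.
  apply: nr => /=; split; first exact/asboolP.
  apply: (reach_trans _ (reach_trans (reach_step (_ : A (s + i') w _)) r2')).
    by apply: reach_wait; rewrite ltn_add2l.
  by rewrite A_sym.
move=> d d' dD dD' cc; case: (leqP d.2 d'.2) => h; first exact: key.
by apply/esym/key => //; apply: ltnW.
Qed.

End Core.

(** Greedy choice in the digraph with arcs from [u] to [Z u]: out-degrees are at most [d], so some
    vertex has in-degree at most [d]; keep it, delete its at most [2 * d] neighbours, and repeat. *)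
Lemma indep_subset (V : finType) (Z : V -> {set V}) (d : nat) (Y : {set V}) :
  {in Y, forall u, #|Z u| <= d} ->
  exists Y' : {set V}, [/\ Y' \subset Y,
    {in Y' &, forall u u', u != u' -> u' \notin Z u} &
    #|Y| <= (2 * d).+1 * #|Y'|].
Proof.
have [n] := ubnP #|Y|; elim: n Y => // n IH Y Yn hZ.
have [->|[y yY]] := set_0Vmem Y.
  by exists set0; split=> [|u u'|]; rewrite ?sub0set ?inE // cards0.
pose pre u := [set v in Y | u \in Z v].
have [u uY preu] : exists2 u, u \in Y & #|pre u| <= d.
  apply/exists_inP; apply: contraT => /exists_inPn h.
  have le1 : d.+1 * #|Y| <= \sum_(u in Y) #|pre u|.
    rewrite mulnC -sum_nat_const; apply: leq_sum => u uY.
    by rewrite ltnNge h.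
  have le2 : \sum_(u in Y) #|pre u| <= d * #|Y|.
    have -> : \sum_(u in Y) #|pre u| = \sum_(v in Y) \sum_(u in Y | u \in Z v) 1.
      rewrite [RHS](exchange_big_dep (mem Y)) /=; last by move=> v u _ /andP[].
      apply: eq_bigr => u uY.
      rewrite -sum1_card; apply: eq_bigl => v; rewrite inE.
      by rewrite uY andTb.
    rewrite mulnC -sum_nat_const; apply: leq_sum => v vY.
    rewrite sum1dep_card; apply: leq_trans (hZ v vY).
    by apply/subset_leq_card/subsetP => w; rewrite inE => /andP[].
  have : 0 < #|Y| by apply/card_gt0P; exists y.
  by nia.
pose N := u |: (Z u :|: pre u).
have cN : #|N| <= (2 * d).+1.
  apply: leq_trans (leq_card_setU _ _) _; rewrite cards1 add1n ltnS.
  by apply: leq_trans (leq_card_setU _ _) _; rewrite mul2n -addnn leq_add // hZ.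
have Yu : #|Y| <= #|N| + #|Y :\: N|.
  by rewrite -(cardsID N Y) leq_add2r subset_leq_card // subsetIr.
have [||Y' [sY' iY' cY']] := IH (Y :\: N).
- rewrite -ltnS; apply: leq_trans Yn; rewrite ltnS proper_card //.
  apply/properP; split; first exact: subsetDl.
  by exists u => //; rewrite !inE eqxx.
- by move=> v /setDP[vY _]; apply: hZ.
have nY' v : v \in Y' -> [/\ v != u, v \notin Z u & u \notin Z v].
  move=> /(subsetP sY'); rewrite !inE => /andP[]; rewrite !negb_or.
  by case/and3P=> -> -> h vY; rewrite vY in h.
exists (u |: Y'); split.
- rewrite subUset sub1set uY; apply: subset_trans sY' (subsetDl _ _).
- move=> v v'; rewrite !inE => /orP[/eqP->|vY] /orP[/eqP->|vY'].
  + by rewrite eqxx.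
  + by have [_ h _] := nY' _ vY'.
  + by have [_ _ h] := nY' _ vY.
  + exact: iY'.
- rewrite cardsU1; have -> : u \notin Y'.
    by apply/negP => /nY'[]; rewrite eqxx.
  by move: Yu cN cY' => /=; nia.
Qed.

Lemma pigeonhole_sum (M B : nat) (c : nat -> nat) :
  0 < M -> \sum_(i < M) c i <= M * B -> exists2 i, i < M & c i <= B.
Proof.
move=> M0 h; have [/existsP[i ci]|/existsPn n] := boolP [exists i : 'I_M, c i <= B].
  by exists i.
have : \sum_(i < M) B.+1 <= \sum_(i < M) c i.
  by apply: leq_sum => i _; rewrite ltnNge.
by rewrite sum_nat_const card_ord; nia.
Qed.

(** * Quiet windows and the conflicts inside them *)

Section Windows.
Variables (V : finType) (A : nat -> rel V).

Lemma sum_drop g s l M v : tmono A g ->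
  \sum_(i < M) (g (s + i * l) v - g (s + i * l + l) v) =
  g s v - g (s + M * l) v.
Proof.
move=> mg; elim: M => [|M IH]; first by rewrite big_ord0 addn0 subnn.
rewrite big_ord_recr /= IH.
have h1 := @tmono_wait _ _ _ s (s + M * l) v mg (leq_addr _ _).
have h2 := @tmono_wait _ _ _ (s + M * l) (s + M * l + l) v mg (leq_addr _ _).
have -> : s + M.+1 * l = s + M * l + l by rewrite mulSn; lia.
by lia.
Qed.

(** One averaging serves both requirements: the two drops are added with weights [2 * E] and [#|Y|],
    and [2 * h + h' <= M] bounds the average cost of a window by [E * #|Y|]. *)
Lemma quiet_window g (a : V -> nat) (Y : {set V}) s l M h h' :
  tmono A g -> 0 < #|Y| -> 0 < \sum_w a w -> 0 < M -> 2 * h + h' <= M ->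
  \sum_(u in Y) (g s u - g (s + M * l) u) <= h * #|Y| ->
  \sum_w a w * (g s w - g (s + M * l) w) <= h' * \sum_w a w ->
  exists2 i, i < M &
    let t := s + i * l in
    #|Y| <= 2 * #|[set u in Y | g (t + l) u == g t u]| /\
    \sum_w a w * (g t w - g (t + l) w) <= \sum_w a w.
Proof.
set E := \sum_w a w => mg Y0 E0 M0 hM hY hE.
pose dr i v := g (s + i * l) v - g (s + i * l + l) v.
pose c i := 2 * E * \sum_(u in Y) dr i u + #|Y| * \sum_w a w * dr i w.
have [|i iM ci] := @pigeonhole_sum M (E * #|Y|) c M0.
  rewrite big_split /= -!big_distrr /= exchange_big /=.
  under eq_bigr do rewrite (sum_drop _ _ _ _ mg).
  rewrite [X in _ + _ * X]exchange_big /=.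
  under [X in _ + _ * X]eq_bigr do rewrite -big_distrr /= (sum_drop _ _ _ _ mg).
  apply: leq_trans (_ : 2 * E * (h * #|Y|) + #|Y| * (h' * E) <= _).
    by rewrite leq_add // leq_mul.
  by rewrite (_ : _ + _ = (2 * h + h') * (E * #|Y|)) ?leq_mul //; lia.
exists i => //=; move: ci; rewrite /c => ci; split; last first.
  rewrite -(leq_pmul2l Y0); apply: leq_trans (leq_addl _ _) (leq_trans ci _).
  by rewrite mulnC.
have {ci} ci : 2 * \sum_(u in Y) dr i u <= #|Y|.
  rewrite -(leq_pmul2l E0) mulnA [E * 2]mulnC.
  exact: leq_trans (leq_addr _ _) ci.
set t := s + i * l; set Y' := [set u in Y | _].
have : #|Y :\: Y'| <= \sum_(u in Y) dr i u.
  rewrite -sum1_card; apply: leq_trans (_ : \sum_(u in Y :\: Y') dr i u <= _).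
    apply: leq_sum => u; rewrite !inE => /andP[ne uY]; rewrite uY /= in ne.
    rewrite subn_gt0 ltn_neqAle ne /=.
    by apply: tmono_wait mg _; rewrite leq_addr.
  rewrite [X in _ <= X](bigID (mem (Y :\: Y'))) /=.
  apply: leq_trans (leq_addr _ _); rewrite leq_eqVlt; apply/orP; left.
  apply/eqP/eq_bigl => u; rewrite !inE.
  by case: (u \in Y); rewrite /= ?andbF // andbT.
have := cardsID Y' Y; have -> : Y :&: Y' = Y'.
  by apply/setIidPr/subsetP => u; rewrite inE => /andP[].
by lia.
Qed.

End Windows.

Section Conflicts.
Variables (V : finType) (A : nat -> rel V) (e : rel V).
Hypothesis A_sym : forall t, symmetric (A t).
Hypothesis A_conn : forall t x y, connect (A t) x y.
Hypothesis A_sub : forall t x y, A t x y -> e x y.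

Let deg (w : V) : nat := #|[set k | e w k]|.

(** Thin [Y] to a set without conflicts and apply [indep_bound]; the successor in its sum costs one
    more degree sum, whence the 4. The bound on [l] covers a thinned set of at most one vertex. *)
Lemma conflict_bound (g : nat -> V -> nat) (Z : V -> {set V}) (s l d : nat)
    (Y : {set V}) :
  tmono A g -> l <= 2 * \sum_w deg w ->
  {in Y, forall u, g (s + l) u = g s u} ->
  {in Y, forall u, #|Z u| <= d} ->
  {in Y &, forall u u', u != u' -> g s u = g s u' -> reach A s u (s + l) u' ->
    u' \in Z u} ->
  \sum_w deg w * (g s w - g (s + l) w) <= \sum_w deg w ->
  #|Y| * l <= (2 * d).+1 * (4 * \sum_w deg w).
Proof.
move=> mg lE gY Zd YZ hE.
have [Y' [sY' iY' cY']] := indep_subset Zd.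
suff h : #|Y'| * l <= 4 * \sum_w deg w.
  by apply: leq_trans (leq_mul cY' (leqnn l)) _; rewrite -mulnA leq_mul2l h orbT.
case: (leqP #|Y'| 1) => [Y1|Y2].
  by apply: leq_trans (leq_mul Y1 lE) _; lia.
have /= := indep_bound A_sym A_conn A_sub mg Y2 (l := l) (s := s).
move=> h; apply: leq_trans (h _ _) _.
- by move=> u uY; apply/gY/(subsetP sY').
- move=> u u' uY uY' nu gu r; have := iY' _ _ uY uY' nu.
  by rewrite YZ // (subsetP sY').
- rewrite -/deg (_ : \sum_w _ = \sum_w deg w * (g s w - g (s + l) w) + \sum_w deg w).
    by lia.
  by rewrite -big_split; apply: eq_bigr => w _; rewrite /= mulnS addnC.
Qed.

End Conflicts.

(** * Capped levels, branching trees, families with few overlaps *)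

Definition lev (H : nat) (P : nat -> Prop) : nat := \max_(j < H.+1 | `[< P j >]) j.

Lemma lev_le H P : lev H P <= H.
Proof. by apply/bigmax_leqP => j _; rewrite -ltnS ltn_ord. Qed.

Lemma lev_max H P j : P j -> j <= H -> j <= lev H P.
Proof.
move=> Pj jH; apply: (@leq_bigmax_cond _ _ _ (Ordinal (n := H.+1) (m := j) jH)).
exact/asboolP.
Qed.

Lemma lev_sat H (P : nat -> Prop) : P 0 -> P (lev H P).
Proof.
move=> P0; have h : 0 < #|[pred j : 'I_H.+1 | `[< P j >]]|.
  by apply/card_gt0P; exists ord0; apply/asboolP.
by have [i /asboolP Pi e] := eq_bigmax_cond (fun j : 'I_H.+1 => nat_of_ord j) h; rewrite /lev e.
Qed.

Lemma lev_sub H (P P' : nat -> Prop) : P 0 -> (forall j, P j -> P' j) ->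
  lev H P <= lev H P'.
Proof. by move=> P0 h; apply: lev_max; [apply: h; apply: lev_sat|apply: lev_le]. Qed.

Section Branching.
Variables (V : finType) (A : nat -> rel V).

Fixpoint branch (q f : nat) (S : {set V}) (k t : nat) (v : V) : Prop :=
  if k is k'.+1 then
    exists S' : {set V}, [/\ S' \subset S, q <= #|S'| &
      {in S', forall u, exists t', [/\ t' <= f, reach A t v t' u & branch q f S k' t' u]}]
  else True.

Lemma branch_reach q f S k t v t1 v1 :
  reach A t v t1 v1 -> branch q f S k t1 v1 -> branch q f S k t v.
Proof.
case: k => // k r [S' [sS qS h]]; exists S'; split=> // u /h[t' [tf r' b]].
by exists t'; split=> //; apply: reach_trans r r'.
Qed.

(** Descend the tree, taking at each node a child outside [U] and adding it to [U]; [#|U| + k <= q]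
    keeps such a child available. With [U] empty, depth [q] yields [q] distinct vertices of [S]. *)
Lemma branch_walk q f S k t v (U : {set V}) :
  branch q f S k t v -> t <= f -> #|U| + k <= q ->
  exists t' p, [/\ t <= t' <= f, traj A t t' p, p t = v,
    k <= #|(vis p t t' :&: S) :\: U| & p t' \in S \/ p t' = v].
Proof.
elim: k t v U => [|k IH] t v U.
  move=> _ tf _; exists t, (fun=> v); split; rewrite ?leqnn //; last by right.
  by move=> i; lia.
move=> [S' [sS qS h]] tf Uq.
have [u uS uU] : exists2 u, u \in S' & u \notin U.
  apply/exists_inP; apply: contraT => /exists_inPn n.
  have : S' \subset U by apply/subsetP => u /n; rewrite negbK.
  by move=> /subset_leq_card; lia.
have [t1 [t1f [tt1 [p [hp pv pu]]] b]] := h u uS.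
have [|t2 [p' [/andP[t12 t2f] hp' pu' vk e]]] := IH t1 u (u |: U) b t1f.
  by rewrite cardsU1 uU; lia.
have pp : p t1 = p' t1 by rewrite pu pu'.
exists t2, (tcat t1 p p'); split.
- by rewrite (leq_trans tt1 t12).
- exact: traj_cat hp hp' pp.
- by rewrite tcat_l.
- have : u |: ((vis p' t1 t2 :&: S) :\: (u |: U)) \subset
      (vis (tcat t1 p p') t t2 :&: S) :\: U.
    rewrite subUset sub1set !inE uU (subsetP sS u uS) andbT.
    rewrite (subsetP (vis_catl _ _ _ t12)) /=; last first.
      by apply/visP; exists t1; rewrite ?tt1 ?leqnn.
    apply/subsetP => a; rewrite !inE negb_or => /andP[/andP[_ ->] /andP[av ->]].
    by rewrite (subsetP (vis_catr _ tt1 pp)).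
  by move=> /subset_leq_card; rewrite cardsU1 !inE eqxx /=; lia.
- rewrite tcat_r //; left; case: e => // ->; exact: (subsetP sS).
Qed.

End Branching.

(** Enlarge the family greedily inside the part of [X0] that is neither chosen nor saturated, that
    is, already in [q] sets. At most [#|X1|] vertices are saturated, so this stops only once
    [#|X0| - 2 * #|X1|] is below [x / 4]. *)
Lemma spread_family (V : finType) (X0 : {set V}) (plan : V -> {set V} -> Prop)
    (q x : nat) : 0 < q ->
  (forall Y : {set V}, Y \subset X0 -> x <= 4 * #|Y| ->
    exists u (B : {set V}), [/\ u \in Y, B \subset Y, #|B| = q & plan u B]) ->
  exists (X1 : {set V}) (B : V -> {set V}),
    [/\ X1 \subset X0, {in X1, forall u, plan u (B u) /\ #|B u| = q},
        forall a, #|[set u in X1 | a \in B u]| <= q &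
        4 * #|X0| < 8 * #|X1| + x].
Proof.
move=> q0 hplan.
pose valid (X1 : {set V}) (B : V -> {set V}) :=
  [/\ X1 \subset X0, {in X1, forall u, plan u (B u) /\ #|B u| = q} &
      forall a, #|[set u in X1 | a \in B u]| <= q].
pose goal := exists (X1 : {set V}) B, valid X1 B /\ 4 * #|X0| < 8 * #|X1| + x.
suff [X1 [B [[? ? ?] ?]]] : goal by exists X1, B.
have [//|ngoal] := pselect goal.
(* Were the goal never met, the family would outgrow [X0]. *)
suff : forall k, exists X1 B, valid X1 B /\ #|X1| = k.
  move=> /(_ #|X0|.+1) [X1 [B [[sX _ _] cX]]].
  by have := subset_leq_card sX; rewrite cX ltnn.
elim=> [|k [X1 [B [[sX hB load] cX]]]].
  exists set0, (fun=> set0); split; last exact: cards0.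
  split=> [|u|a]; rewrite ?sub0set ?inE //.
  by rewrite (_ : [set _ in _ | _] = set0) ?cards0 //; apply/setP => u; rewrite !inE.
pose L a := [set u in X1 | a \in B u].
pose sat := [set a | q <= #|L a|].
have csat : #|sat| <= #|X1|.
  rewrite -(leq_pmul2r q0).
  apply: (@leq_trans (\sum_(a in sat) #|L a|)).
    by rewrite -sum_nat_const; apply: leq_sum => a; rewrite inE.
  apply: (@leq_trans (\sum_a #|L a|)).
    by rewrite [X in _ <= X](bigID (mem sat)) /= leq_addr.
  have -> : \sum_a #|L a| = \sum_(u in X1) \sum_(a in B u) 1.
    rewrite [RHS](exchange_big_dep xpredT) //=; apply: eq_bigr => a _.
    by rewrite -sum1_card; apply: eq_bigl => u; rewrite inE.
  rewrite -sum_nat_const; apply: leq_sum => u uX.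
  by rewrite sum1_card; have [_ ->] := hB u uX.
pose Y := (X0 :\: X1) :\: sat.
have cY : #|X0| <= #|X1| + #|sat| + #|Y|.
  have h1 := cardsID X1 X0; have h2 := cardsID sat (X0 :\: X1).
  have := subset_leq_card (subsetIr X0 X1).
  by have := subset_leq_card (subsetIr (X0 :\: X1) sat); rewrite /Y; lia.
have [||u [B0 [uY sB cB pl]]] := hplan Y.
- by apply/subsetP => u; rewrite !inE => /and3P[].
- rewrite leqNgt; apply/negP => h; apply: ngoal; exists X1, B; split=> //.
  by lia.
have [usat uX1 uX0] : [/\ u \notin sat, u \notin X1 & u \in X0].
  by move: uY; rewrite !inE => /and3P[].
exists (u |: X1), (fun v => if v == u then B0 else B v); split; last first.
  by rewrite cardsU1 uX1 cX.
split.
- by rewrite subUset sub1set uX0.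
- move=> v; rewrite !inE; case: eqP => [->|_] //= vX; exact: hB.
- move=> a; case: (boolP (a \in B0)) => aB.
    have : #|L a| < q.
      by move: (subsetP sB a aB); rewrite !inE ltnNge => /andP[].
    apply: leq_trans; rewrite (_ : #|L a|.+1 = #|u |: L a|).
      apply/subset_leq_card/subsetP => v; rewrite !inE.
      by case: eqP.
    by rewrite cardsU1 !inE (negbTE uX1).
  apply: leq_trans (load a); apply/subset_leq_card/subsetP => v; rewrite !inE.
  by case: eqP => [->|_] /=; rewrite ?(negbTE aB).
Qed.

(** * Collecting walks that keep the level of a potential *)

Section LevelWalk.
Variables (V : finType) (A : nat -> rel V) (e : rel V).
Hypothesis A_sym : forall t, symmetric (A t).
Hypothesis A_conn : forall t x y, connect (A t) x y.
Hypothesis A_sub : forall t x y, A t x y -> e x y.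

Let deg (w : V) : nat := #|[set k | e w k]|.
Let E : nat := \sum_w deg w.

(* The potential refines lam lexicographically by the depth, cut at q, of the tree
   with q-fold branching that can be followed inside the current level set of lam. *)
Lemma level_walk (lam : nat -> V -> nat) (Y : {set V}) (s l q : nat) :
  tmono A lam -> 0 < q -> 0 < E -> l <= 2 * E ->
  {in Y, forall u, lam (s + 5 * q * l) u = lam s u} ->
  \sum_w deg w * (lam s w - lam (s + 5 * q * l) w) <= E ->
  (2 * q).+1 * (8 * E) < #|Y| * l ->
  exists u (B : {set V}) t' p, [/\ u \in Y, B \subset Y, #|B| = q,
    s <= t' <= s + 5 * q * l & [/\ traj A s t' p, p s = u, B \subset vis p s t'
    & lam s u <= lam t' (p t')]].
Proof.
move=> ml q0 E0 lE constY hE big; set f := s + 5 * q * l.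
pose Yj j := [set u in Y | lam s u == j].
have lamY u t : u \in Y -> s <= t <= f -> lam t u = lam s u.
  move=> uY /andP[st tf]; apply/eqP; rewrite eqn_leq (tmono_wait _ ml) //=.
  by rewrite -(constY u uY) (tmono_wait _ ml).
pose sec t v := lev q (fun k => branch A q f (Yj (lam t v)) k t v).
pose phi t v := q.+1 * lam t v + sec t v.
have secq t v : sec t v <= q by apply: lev_le.
have phi_inj t v t' v' : phi t v = phi t' v' -> lam t v = lam t' v' /\ sec t v = sec t' v'.
  have div r w : phi r w %/ q.+1 = lam r w.
    by rewrite /phi mulnC divnMDl // divn_small ?addn0 // ltnS.
  move=> ee; have el : lam t v = lam t' v' by rewrite -!div ee.
  by split=> //; move: ee; rewrite /phi el => /addnI.
have mphi : tmono A phi.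
  move=> t v w vw; rewrite /phi; have := ml t v w vw; rewrite leq_eqVlt.
  case/orP => [/eqP el|ll]; last by have := secq t.+1 w; nia.
  rewrite el leq_add2l /sec el; apply: lev_sub => // k; apply: branch_reach.
  by case: vw => [->|]; [apply: reach_wait|apply: reach_step].
(* A tree of depth [q] at the start yields the walk, which collects vertices on the level of [u] and
   also ends on it. *)
have [[u uY bu]|nb] := pselect (exists2 u, u \in Y & branch A q f (Yj (lam s u)) q s u).
  have sf : s <= f by rewrite leq_addr.
  have [|t' [p [tf hp pu vq eu]]] := branch_walk (U := set0) bu sf.
    by rewrite cards0.
  rewrite setD0 in vq.
  have [B sB cB] : exists2 B : {set V}, B \subset vis p s t' :&: Yj (lam s u) & #|B| = q.
    have [B [cB sB]] : exists B : {set V}, [/\ #|B| == q & B \subset vis p s t' :&: Yj (lam s u)].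
      have : 0 < #|[set B : {set V} | B \subset vis p s t' :&: Yj (lam s u) & #|B| == q]|.
        by rewrite cards_draws bin_gt0.
      by case/card_gt0P => B; rewrite inE => /andP[? ?]; exists B.
    by exists B => //; apply/eqP.
  exists u, B, t', p; split=> //.
    by apply: subset_trans sB _; apply/subsetP => a; rewrite !inE => /and3P[].
  split=> //; first by apply: subset_trans sB (subsetIl _ _).
  case: eu => [|->]; last by rewrite lamY.
  by rewrite inE => /andP[eY /eqP <-]; rewrite (lamY _ t').
exfalso.
have Y0 : 0 < #|Y| by rewrite lt0n; apply: contraTneq big => ->.
have M0 : 0 < 5 * q by rewrite muln_gt0.
have sum1 : \sum_(u in Y) (phi s u - phi f u) <= q * #|Y|.
  rewrite mulnC -sum_nat_const; apply: leq_sum => u uY.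
  rewrite /phi (lamY u f) ?leqnn ?leq_addr //.
  by have := secq s u; lia.
(* The drop of [phi] is at most [q.+1] times that of [lam] plus [q], in total at most
   [(2 * q + 1) * E]. With [sum1] this requires [2 * q + 3 * q] windows. *)
have sum2 : \sum_w deg w * (phi s w - phi f w) <= 3 * q * E.
  apply: (@leq_trans (q.+1 * \sum_w deg w * (lam s w - lam f w) + q * E)).
    rewrite /E !big_distrr -big_split /=; apply: leq_sum => w _.
    have := secq s w; have := tmono_wait w ml (leq_addr _ _ : s <= f); rewrite /phi.
    move=> h1 h2; rewrite mulnCA [q * _]mulnC -mulnDr leq_mul2l; apply/orP; right.
    by rewrite mulnBr; lia.
  by move: hE; rewrite -/f => hE; nia.
have MM : 2 * q + 3 * q <= 5 * q by lia.
have [i iM /=] := quiet_window mphi Y0 E0 M0 MM sum1 sum2.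
set t0 := s + i * l; set Y' := [set u in Y | _] => -[cY' sum3].
have t0f : t0 + l <= f.
  by rewrite /t0 /f -addnA leq_add2l addnC -mulSn leq_mul2r iM orbT.
have st0 : s <= t0 by rewrite leq_addr.
have secY u : u \in Y -> sec t0 u < q.
  move=> uY; rewrite ltn_neqAle secq andbT; apply/eqP => eq.
  apply: nb; exists u => //; rewrite -(lamY u t0) //; last first.
    by rewrite st0 (leq_trans _ t0f) ?leq_addr.
  apply: branch_reach (reach_wait A u st0) _; rewrite -{2}eq.
  exact: (@lev_sat _ (fun k => branch A q f (Yj (lam t0 u)) k t0 u)).
(* For [u] in [Y'], [q] vertices of [Z u] would be the children of a tree deeper than [sec t0 u]. *)
pose Z u := [set u' in Y' | (phi t0 u == phi t0 u') && `[< reach A t0 u (t0 + l) u' >]].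
have : #|Y'| * l <= (2 * q).+1 * (4 * E).
  apply: (conflict_bound A_sym A_conn A_sub (g := phi) (Z := Z) (s := t0)) => //.
  - by move=> u; rewrite inE => /andP[_ /eqP].
  - move=> u; rewrite inE => /andP[uY _]; rewrite leqNgt; apply/negP => qZ.
    have lu : lam t0 u = lam s u.
      by apply: lamY; rewrite // st0 (leq_trans _ t0f) ?leq_addr.
    suff : (sec t0 u).+1 <= sec t0 u by rewrite ltnn.
    apply: lev_max; last exact: secY.
    exists (Z u); split.
    + apply/subsetP => u'; rewrite !inE => /andP[/andP[u'Y _] /andP[/eqP/phi_inj[el _] _]].
      rewrite u'Y el /=; apply/eqP/esym/lamY => //.
      by rewrite st0 (leq_trans _ t0f) ?leq_addr.
    + exact: ltnW.
    + move=> u'; rewrite !inE => /andP[/andP[u'Y /eqP/phi_inj[cl cs]] /andP[/eqP/phi_inj[el es] /asboolP r]].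
      exists (t0 + l); split=> //; rewrite es -cs el -cl.
      exact: (@lev_sat _ (fun k => branch A q f (Yj (lam (t0 + l) u')) k (t0 + l) u')).
  - by move=> u u' uY uY' _ eg r; rewrite inE uY' eg eqxx; apply/asboolP.
by move: big cY'; nia.
Qed.

End LevelWalk.

(** * Robust collection against an opponent *)

Section RobustWalks.
Variables (V : finType) (A : nat -> rel V).

(* robust X m h f j t v: from v at time t, at least h new vertices of X can be
   collected j times in succession before time f, whichever m vertices an
   opponent declares to be old before each of the j rounds. *)
Fixpoint robust (X : {set V}) (m h f j t : nat) (v : V) : Prop :=
  if j is j'.+1 then
    forall Q : {set V}, #|Q| <= m ->
      exists t' p, [/\ t <= t' <= f, traj A t t' p, p t = v,
        h <= #|(vis p t t' :&: X) :\: Q| & robust X m h f j' t' (p t')]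
  else True.

Lemma robust_reach X m h f j t v t1 v1 :
  reach A t v t1 v1 -> robust X m h f j t1 v1 -> robust X m h f j t v.
Proof.
case: j => // j [tt1 [p [hp pv pv1]]] hr Q Qm.
have [t' [p' [/andP[t1t' t'f] hp' pv1' hh hj]]] := hr Q Qm.
have pp : p t1 = p' t1 by rewrite pv1 pv1'.
exists t', (tcat t1 p p'); split.
- by rewrite (leq_trans tt1).
- exact: traj_cat hp hp' pp.
- by rewrite tcat_l.
- apply: leq_trans hh (subset_leq_card _); apply: setSD; apply: setSI.
  exact: vis_catr.
- by rewrite tcat_r.
Qed.

(** Play the first round against the empty set, then carry the remaining rounds back to time [t]. *)
Lemma robust_le X m h f j j' t v :
  j <= j' -> robust X m h f j' t v -> robust X m h f j t v.
Proof.
elim: j' => [|j' IH]; first by rewrite leqn0 => /eqP->.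
rewrite leq_eqVlt => /orP[/eqP->//|jj'] hr; apply: IH => //.
have [|t' [p [/andP[tt' _] hp pv _]]] := hr set0; first by rewrite cards0.
by apply: robust_reach; rewrite -pv; apply: reach_traj.
Qed.

(** Declare old the set [Q] and all vertices of [X] visited so far: each round adds [h] vertices
    until more than [m] are old. *)
Lemma robust_walk X m h f j t v (Q : {set V}) :
  robust X m h f j t v -> t <= f ->
  exists t' p, [/\ t <= t' <= f, traj A t t' p, p t = v &
    minn m (#|Q| + j * h) <= #|Q :|: (vis p t t' :&: X)|].
Proof.
elim: j t v Q => [|j IH] t v Q hr tf.
  exists t, (fun=> v); split=> //; [by rewrite leqnn|by move=> i; lia|].
  by rewrite addn0 geq_min; apply/orP; right; apply/subset_leq_card/subsetUl.
case: (leqP #|Q| m) => Qm; last first.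
  exists t, (fun=> v); split=> //; [by rewrite leqnn|by move=> i; lia|].
  rewrite geq_min; apply/orP; left; apply: leq_trans (ltnW Qm) _.
  exact/subset_leq_card/subsetUl.
have [t1 [p [/andP[tt1 t1f] hp pv hh hr']]] := hr Q Qm.
have [t2 [p' [/andP[t12 t2f] hp' pv' hm]]] := IH _ _ (Q :|: (vis p t t1 :&: X)) hr' t1f.
exists t2, (tcat t1 p p'); split.
- by rewrite (leq_trans tt1).
- exact: traj_cat hp hp' (esym pv').
- by rewrite tcat_l.
- apply: (@leq_trans (minn m (#|Q :|: (vis p t t1 :&: X)| + j * h))).
    rewrite leq_min geq_minl geq_min /= mulSn addnA leq_add2r; apply/orP; right.
    have : Q :|: ((vis p t t1 :&: X) :\: Q) \subset Q :|: (vis p t t1 :&: X).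
      by rewrite setUS // subsetDl.
    move=> /subset_leq_card; rewrite cardsU.
    rewrite (_ : Q :&: _ = set0) ?cards0 ?subn0; first by lia.
    by apply/setP => a; rewrite !inE; case: (a \in Q).
  apply: leq_trans hm (subset_leq_card _); rewrite -setUA -setIUl.
  apply: setUS; apply: setSI; rewrite subUset vis_catl //=.
  by apply: vis_catr.
Qed.

End RobustWalks.

(** * Collecting [h ^ 2] unvisited vertices within [n] steps *)

Section Phase.
Variables (V : finType) (A : nat -> rel V) (e : rel V).
Hypothesis A_sym : forall t, symmetric (A t).
Hypothesis A_conn : forall t x y, connect (A t) x y.
Hypothesis A_sub : forall t x y, A t x y -> e x y.

Let deg (w : V) : nat := #|[set k | e w k]|.
Let E : nat := \sum_w deg w.

(* If there were no such v, the robustness level would be almost constant during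
   some window. Its second part provides, at the same level, walks u |-> B u with
   few overlaps; the opponent's set of u spoils only few of the walks B u', so u can
   reach during the first part some u' of the same level with B u' not spoiled. *)
Lemma robust_exists (X : {set V}) (m h H s l1 l2 : nat) :
  0 < h -> 0 < H -> 0 < #|X| -> 0 < E -> l1 <= 2 * E -> l2 <= 2 * E ->
  32 * ((4 * m).+1 * E) < #|X| * l1 ->
  32 * ((4 * h).+1 * E) < #|X| * l2 ->
  exists v, robust A X m h (s + 3 * H * (l1 + 10 * h * l2)) H s v.
Proof.
move=> h0 H0 X0' E0 l1E l2E big1 big2; set l := l1 + _; set f := s + _.
have [//|nr] := pselect (exists v, robust A X m h f H s v); exfalso.
pose lam t v := lev H (fun j => robust A X m h f j t v).
have ml : tmono A lam.
  move=> t v w vw; apply: lev_sub => // j; apply: robust_reach.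
  by case: vw => [->|]; [apply: reach_wait|apply: reach_step].
have lam_sat t v : robust A X m h f (lam t v) t v.
  exact: (@lev_sat _ (fun j => robust A X m h f j t v)).
have lamH t v : s <= t -> lam t v < H.
  move=> st; apply: leq_ltn_trans (tmono_wait _ ml st) _.
  rewrite ltn_neqAle lev_le andbT; apply/eqP => eH.
  by apply: nr; exists v; rewrite -[X in robust _ _ _ _ _ X]eH.
have M0 : 0 < 3 * H by rewrite muln_gt0.
have MM : 2 * H + H <= 3 * H by lia.
have drH t w : lam s w - lam t w <= H by apply: leq_trans (leq_subr _ _) (lev_le _ _).
have sum1 : \sum_(u in X) (lam s u - lam (s + 3 * H * l) u) <= H * #|X|.
  by rewrite [X in _ <= X]mulnC -sum_nat_const; apply: leq_sum.
have sum2 : \sum_w deg w * (lam s w - lam (s + 3 * H * l) w) <= H * E.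
  by rewrite /E big_distrr; apply: leq_sum => w _; rewrite mulnC leq_mul2r drH orbT.
have [i iM /=] := quiet_window ml X0' E0 M0 MM sum1 sum2.
set t0 := s + i * l; set X0 := [set u in X | _] => -[cX0 sum3].
pose t2 := t0 + l1.
have tef : t0 + l <= f.
  by rewrite /t0 /f -addnA leq_add2l addnC -mulSn leq_mul2r iM orbT.
have tel : t0 + l = t2 + 5 * (2 * h) * l2 by rewrite /t2 /l; lia.
have st0 : s <= t0 by rewrite leq_addr.
have t02 : t0 <= t2 by rewrite leq_addr.
have t2e : t2 <= t0 + l by rewrite tel leq_addr.
have lamX u t : u \in X0 -> t0 <= t <= t0 + l -> lam t u = lam t0 u.
  rewrite inE => /andP[_ /eqP eu] /andP[tt te]; apply/eqP.
  by rewrite eqn_leq (tmono_wait _ ml) //= -eu (tmono_wait _ ml).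
(* Plans live in the second part of the window. They will collect [2 * h] vertices, so that enough
   remain when fewer than [h] are blocked. *)
pose plan u (B : {set V}) := B \subset X /\ exists t' p,
  [/\ t2 <= t' <= t0 + l, traj A t2 t' p, p t2 = u, B \subset vis p t2 t'
    & lam t0 u <= lam t' (p t')].
have q0 : 0 < 2 * h by rewrite muln_gt0.
have plans (Y : {set V}) : Y \subset X0 -> #|X| <= 4 * #|Y| ->
    exists u (B : {set V}), [/\ u \in Y, B \subset Y, #|B| = 2 * h & plan u B].
  move=> sY cY.
  have [|||u [B [t' [p [uY sB cB tt [hp pu vB lu]]]]]] :=
      @level_walk _ A e A_sym A_conn A_sub lam Y t2 l2 (2 * h) ml q0 E0 l2E.
  - move=> u uY; rewrite -tel !lamX ?(subsetP sY) //; rewrite ?leqnn ?t02 ?t2e //.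
    by rewrite leq_addr.
  - rewrite -tel; apply: leq_trans sum3; apply: leq_sum => w _.
    rewrite leq_mul2l; apply/orP; right.
    by apply: leq_sub2r; apply: tmono_wait ml _.
  - by move: big2 cY; rewrite -/deg -/E; nia.
  exists u, B; split=> //; split.
    apply: subset_trans sB (subset_trans sY _).
    by apply/subsetP => a; rewrite inE => /andP[].
  exists t', p; split=> //; rewrite ?tel //.
  by apply: leq_trans lu; rewrite lamX ?t02 ?t2e // (subsetP sY).
have [X1 [B [sX1 hB load cX1]]] := spread_family q0 plans.
(* As [lam t0 u] is maximal and below [H], some set of the opponent rules out one more round from
   [u]. *)
have /choice[Qf QfP] : forall u, exists Q : {set V}, #|Q| <= m /\ ~ (exists t' p,
    [/\ t0 <= t' <= f, traj A t0 t' p, p t0 = u,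
      h <= #|(vis p t0 t' :&: X) :\: Q| & robust A X m h f (lam t0 u) t' (p t')]).
  move=> u; apply: contrapT => hn.
  suff : (lam t0 u).+1 <= lam t0 u by rewrite ltnn.
  apply: lev_max; last exact: lamH.
  move=> Q Qm; apply: contrapT => nQ; apply: hn; exists Q; split=> //.
pose Z u := [set u' in X1 | h <= #|B u' :&: Qf u|].
(* Count incidences: each of the at most [m] elements of [Qf u] lies in at most [2 * h] sets [B u'],
   and each [u'] in [Z u] accounts for [h] of them. *)
have cZ u : #|Z u| <= 2 * m.
  rewrite -(leq_pmul2r h0) mulnAC.
  apply: (@leq_trans (\sum_(u' in Z u) #|B u' :&: Qf u|)).
    by rewrite -sum_nat_const; apply: leq_sum => u'; rewrite inE => /andP[].
  apply: (@leq_trans (\sum_(u' in X1) #|B u' :&: Qf u|)).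
    rewrite [X in _ <= X](bigID (mem (Z u))) /=.
    apply: leq_trans (leq_addr _ _); rewrite leq_eqVlt; apply/orP; left.
    apply/eqP/eq_bigl => u'; rewrite !inE.
    by case: (u' \in X1).
  have -> : \sum_(u' in X1) #|B u' :&: Qf u| =
            \sum_(a in Qf u) #|[set u' in X1 | a \in B u']|.
    have -> : \sum_(u' in X1) #|B u' :&: Qf u| =
              \sum_(u' in X1) \sum_(a in Qf u | a \in B u') 1.
      apply: eq_bigr => u' _; rewrite -sum1_card; apply: eq_bigl => a.
      by rewrite inE andbC.
    rewrite (exchange_big_dep (mem (Qf u))) /=; last by move=> u' a _ /andP[].
    apply: eq_bigr => a aQ; rewrite -sum1_card; apply: eq_bigl => u'.
    by rewrite inE aQ.
  apply: (@leq_trans (\sum_(a in Qf u) 2 * h)); first exact: leq_sum.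
  by rewrite sum_nat_const mulnC leq_mul2l; have [-> _] := QfP u; rewrite orbT.
have sX10 u : u \in X1 -> u \in X0 by apply: (subsetP sX1).
have : #|X1| * l1 <= (2 * (2 * m)).+1 * (4 * E).
  apply: (conflict_bound A_sym A_conn A_sub (g := lam) (Z := Z) (s := t0)) => //.
  - by move=> u /sX10 uX; apply: lamX; rewrite ?t02 ?t2e.
  - move=> u u' uX u'X _ eu [_ [p0 [hp0 p0u p0u']]].
    rewrite inE u'X /= leqNgt; apply/negP => lth.
    have [[sBX [t' [p [/andP[t2t' t'e] hp pu' vB lu']]]] cB] := hB u' u'X.
    have [_ []] := QfP u.
    have pp : p0 t2 = p t2 by rewrite pu' p0u'.
    exists t', (tcat t2 p0 p); split.
    + by rewrite (leq_trans t02 t2t') (leq_trans t'e tef).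
    + exact: traj_cat hp0 hp pp.
    + by rewrite tcat_l.
    + have : B u' :\: Qf u \subset (vis (tcat t2 p0 p) t0 t' :&: X) :\: Qf u.
        apply: setSD; rewrite subsetI sBX andbT; apply: subset_trans vB _.
        exact: vis_catr.
      by move=> /subset_leq_card; apply: leq_trans; have := cardsID (Qf u) (B u'); lia.
    + by rewrite tcat_r //; apply: robust_le (lam_sat _ _); rewrite eu.
  - apply: leq_trans sum3; apply: leq_sum => w _.
    rewrite leq_mul2l; apply/orP; right.
    by apply: leq_sub2l; apply: tmono_wait ml _.
(* [#|X| <= 2 * #|X0|] and [4 * #|X0| < 8 * #|X1| + #|X|] give [#|X| < 8 * #|X1|], against
   [big1]. *)
by move: big1 cX1 cX0; rewrite -/deg -/E; nia.
Qed.

(** Take [m = h ^ 2] and [H = h] in [robust_exists]: [h] rounds of [h] vertices each. *)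
Lemma phase_walk (X : {set V}) (h s : nat) :
  0 < h -> 0 < #|V| <= E -> 33 * 161 * h ^ 3 * E <= #|X| * #|V| ->
  exists t' p, [/\ s <= t' <= s + #|V|, traj A s t' p &
    h ^ 2 <= #|vis p s t' :&: X|].
Proof.
move=> h0 /andP[n0 nE] big; set n := #|V| in n0 nE big *.
have E0 : 0 < E by apply: leq_trans nE.
have xn : #|X| <= n by apply: max_card.
have x0 : 0 < #|X|.
  rewrite lt0n; apply: contraTneq big => ->; rewrite mul0n -ltnNge.
  by rewrite muln_gt0 E0 andbT muln_gt0 expn_gt0 h0.
(* The least lengths that [robust_exists] allows. Rounding up costs [#|X| <= E], so
   [161 = 32 * 5 + 1]; the factor [33 = 3 * (1 + 10)] comes from [T]. *)
pose l1 := (32 * ((4 * h ^ 2).+1 * E)) %/ #|X| + 1.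
pose l2 := (32 * ((4 * h).+1 * E)) %/ #|X| + 1.
have h2 : 0 < h ^ 2 by rewrite expn_gt0 h0.
have a1 : 32 * ((4 * h ^ 2).+1 * E) < #|X| * l1.
  by rewrite /l1 addn1 [#|X| * _]mulnC ltn_ceil.
have a2 : 32 * ((4 * h).+1 * E) < #|X| * l2.
  by rewrite /l2 addn1 [#|X| * _]mulnC ltn_ceil.
have b1 : #|X| * l1 <= 161 * h ^ 2 * E.
  rewrite /l1 mulnDr muln1 [#|X| * _]mulnC.
  have := leq_trunc_div (32 * ((4 * h ^ 2).+1 * E)) #|X|.
  move: (h ^ 2) h2 => k k0; nia.
have b2 : #|X| * l2 <= 161 * h * E.
  rewrite /l2 mulnDr muln1 [#|X| * _]mulnC.
  have := leq_trunc_div (32 * ((4 * h).+1 * E)) #|X|.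
  nia.
pose T := 3 * h * (l1 + 10 * h * l2).
have Tn : T <= n.
  rewrite -(leq_pmul2l x0); apply: leq_trans big; rewrite /T.
  have -> : #|X| * (3 * h * (l1 + 10 * h * l2)) =
            3 * h * (#|X| * l1 + 10 * h * (#|X| * l2)) by lia.
  apply: (@leq_trans (3 * h * (161 * h ^ 2 * E + 10 * h * (161 * h * E)))).
    by rewrite leq_mul2l leq_add ?orbT // leq_mul2l b2 orbT.
  rewrite !expnS expn0 !muln1; lia.
have [||v rv] := @robust_exists X (h ^ 2) h h s l1 l2 h0 h0 x0 E0 _ _ a1 a2.
- by move: Tn; rewrite /T; nia.
- by move: Tn; rewrite /T; nia.
have [t' [p [/andP[st tf] hp _ hm]]] := robust_walk set0 rv (leq_addr _ _).
exists t', p; split=> //.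
  by rewrite st (leq_trans tf) // leq_add2l.
by move: hm; rewrite cards0 add0n set0U mulnn minnn.
Qed.

End Phase.

(* A phase with x unvisited vertices visits about (x n / (c E))^(2/3) of them, so
   about (E / n)^(2/3) x^(1/3) phases suffice; K absorbs the constant, and cubing
   removes the roots. *)
Lemma phase_arith (c n E x p h d : nat) (K := 7 * (56 * c) ^ 2) :
  0 < c -> 0 < n <= E -> 0 < d -> h ^ 2 <= d ->
  x * n < c * h.+1 ^ 3 * E ->
  n ^ 2 * p ^ 3 < K * E ^ 2 * x <= n ^ 2 * p.+1 ^ 3 ->
  K * E ^ 2 * (x - d) <= n ^ 2 * p ^ 3.
Proof.
move=> c0 /andP[n0 nE] d0 hd hx /andP[lo up].
(* [k] covers [h = 0] and satisfies [h.+1 <= 2 * k]; in [56 = 7 * 8] the 8 is the cube of this 2. *)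
pose k := maxn 1 h; pose z := 56 * c.
have k0 : 0 < k by rewrite leq_max.
have kd : k ^ 2 <= d by rewrite /k /maxn; case: ifP.
have hk : h.+1 ^ 3 <= 8 * k ^ 3.
  have -> : 8 * k ^ 3 = (2 * k) ^ 3 by rewrite expnMn.
  by rewrite leq_exp2r // /k; lia.
have pn : p * n < z * k * E.
  rewrite -(@ltn_exp2r _ _ 3) //.
  have -> : (p * n) ^ 3 = n * (n ^ 2 * p ^ 3) by rewrite !expnS !expn0; lia.
  apply: (@leq_trans (n * (K * E ^ 2 * x))); first by rewrite ltn_mul2l n0.
  have -> : n * (K * E ^ 2 * x) = K * E ^ 2 * (x * n) by lia.
  apply: (@leq_trans (K * E ^ 2 * (c * (8 * k ^ 3) * E))).
    rewrite leq_mul2l; apply/orP; right; apply: leq_trans (ltnW hx) _.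
    by rewrite leq_mul2r leq_mul2l hk !orbT.
  rewrite /K -/z.
  have -> : 7 * z ^ 2 * E ^ 2 * (c * (8 * k ^ 3) * E) = z ^ 2 * (56 * c) * k ^ 3 * E ^ 3.
    by rewrite !expnS !expn0; lia.
  by rewrite -/z -expnSr -!expnMn.
have step : n ^ 2 * (p.+1 ^ 3 - p ^ 3) <= K * E ^ 2 * d.
  apply: (@leq_trans (K * E ^ 2 * k ^ 2)); last by rewrite leq_mul2l kd orbT.
  have -> : K * E ^ 2 * k ^ 2 = 7 * (z * k * E) ^ 2.
    by rewrite /K -/z !expnS !expn0; lia.
  apply: (@leq_trans (7 * (maxn 1 p * n) ^ 2)).
    (* This difference is at most [7 * maxn 1 p ^ 2], whence the 7 in [K]. *)
    have -> : p.+1 ^ 3 - p ^ 3 = 3 * p ^ 2 + 3 * p + 1 by rewrite !expnS !expn0; lia.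
    rewrite expnMn [n ^ 2 * _]mulnC mulnA leq_mul2r; apply/orP; right.
    by case: p {lo up pn} => // p; rewrite (maxn_idPr _) //; rewrite !expnS !expn0; nia.
  rewrite leq_mul2l leq_exp2r //=.
  case: (leqP 1 p) => _; first exact: ltnW.
  rewrite mul1n; apply: leq_trans nE _; rewrite leq_pmull // muln_gt0 k0.
  by rewrite muln_gt0 c0.
rewrite mulnBr leq_subLR addnC; apply: leq_trans up _; apply: leq_trans (leq_add (leqnn _) step).
rewrite -mulnDr leq_mul2l; apply/orP; right.
by rewrite subnKC // leq_exp2r.
Qed.

(** * Exploring by repeated phases *)

Section Exploration.
Variables (V : finType) (A : nat -> rel V) (e : rel V).
Hypothesis A_sym : forall t, symmetric (A t).
Hypothesis A_conn : forall t x y, connect (A t) x y.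
Hypothesis A_sub : forall t x y, A t x y -> e x y.

Let deg (w : V) : nat := #|[set k | e w k]|.
Let E : nat := \sum_w deg w.
Let n : nat := #|V|.

(** Snapshots are connected, so the reached set gains a vertex at every step until it is all of
    [V]. *)
Lemma reach_all s u v : reach A s u (s + n) v.
Proof.
pose F d := [set w | `[< reach A s u (s + d) w >]].
have F0 d : u \in F d by rewrite inE; apply/asboolP/reach_wait/leq_addr.
have cF d : minn d.+1 n <= #|F d|.
  elim: d => [|d IH].
    by rewrite geq_min; apply/orP; left; apply/card_gt0P; exists u.
  have sF : F d \subset F d.+1.
    apply/subsetP => w; rewrite !inE => /asboolP r; apply/asboolP.
    by apply: reach_trans r _; apply: reach_wait; rewrite addnS.
  have [fF|[y]] := set_0Vmem (~: F d).
    have : #|F d.+1| = n.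
      have -> : F d.+1 = setT.
        by apply/eqP; rewrite -subTset; apply: subset_trans sF; rewrite -setCS fF sub0set.
      by rewrite cardsT.
    by move=> ->; rewrite geq_minr.
  rewrite inE => yF; have [k [w [kF wF kw]]] := connect_cross (A_conn (s + d) u y) (F0 d) yF.
  have : w |: F d \subset F d.+1.
    rewrite subUset sF andbT sub1set inE; apply/asboolP.
    move: kF; rewrite inE => /asboolP r; apply: reach_trans r _.
    by rewrite addnS; apply: reach_step.
  by move=> /subset_leq_card; rewrite cardsU1 wF; lia.
have : v \in F n.
  have -> : F n = setT by apply/eqP; rewrite eqEcard subsetT cardsT; have := cF n; rewrite -/n; lia.
  by rewrite inE.
by rewrite inE => /asboolP.
Qed.

(** The first [n] steps lead from [u] to the start of the phase. For [h = 0] the target is any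
    vertex of [X], so every phase makes progress. *)
Lemma phase_from (X : {set V}) (h s : nat) (u : V) :
  0 < #|X| -> n <= E -> 33 * 161 * h ^ 3 * E <= #|X| * n ->
  exists p, [/\ traj A s (s + 2 * n) p, p s = u &
    maxn 1 (h ^ 2) <= #|vis p s (s + 2 * n) :&: X|].
Proof.
move=> X0 nE big.
have n0 : 0 < n by apply/card_gt0P; exists u.
have [t' [p [/andP[st te] hp hv]]] : exists t' p, [/\ s + n <= t' <= s + n + n,
    traj A (s + n) t' p & maxn 1 (h ^ 2) <= #|vis p (s + n) t' :&: X|].
  have [h0|h0] := posnP h.
    have [y yX] := card_gt0P X0.
    exists (s + n), (fun=> y); split; rewrite ?leqnn ?leq_addr //.
      by move=> i; lia.
    rewrite h0; apply/card_gt0P; exists y; rewrite inE yX andbT.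
    by apply/visP; exists (s + n); rewrite ?leqnn.
  have nE' : 0 < n <= E by rewrite n0.
  have [t' [p [? ? hv]]] := phase_walk A_sym A_conn A_sub (s + n) h0 nE' big.
  by exists t', p; split=> //; rewrite (maxn_idPr _) // expn_gt0 h0.
have [_ [p0 [hp0 p0u p0v]]] := reach_all s u (p (s + n)).
have e2 : s + 2 * n = s + n + n by lia.
pose p1 := tcat t' p (fun=> p t').
have p1s : p1 (s + n) = p (s + n) by rewrite /p1 tcat_l.
have hp1 : traj A (s + n) (s + n + n) p1.
  by apply: traj_cat hp _ _ => // i _; left.
have pp : p0 (s + n) = p1 (s + n) by rewrite p1s.
exists (tcat (s + n) p0 p1); rewrite e2; split.
- exact: traj_cat hp0 hp1 pp.
- by rewrite tcat_l ?leq_addr.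
- apply: leq_trans hv (subset_leq_card _); apply: setSI.
  apply: subset_trans (vis_catl _ _ _ te) _; exact: vis_catr (leq_addr _ _) pp.
Qed.

(** Induction on the number [P] of phases, with the inequality between [#|X|] and [P ^ 3] as
    invariant; if it already holds for one phase fewer, a phase is spent waiting. *)
Lemma explore (P s : nat) (u : V) (X : {set V}) : n <= E ->
  7 * (56 * (33 * 161)) ^ 2 * E ^ 2 * #|X| <= n ^ 2 * P ^ 3 ->
  exists p, [/\ traj A s (s + P * (2 * n)) p, p s = u &
    X \subset vis p s (s + P * (2 * n))].
Proof.
have [c c0 ec] : exists2 c, 0 < c & c = 33 * 161 by exists (33 * 161).
move=> nE; rewrite -ec.
have n0 : 0 < n by apply/card_gt0P; exists u.
have E0 : 0 < E by apply: leq_trans nE.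
set K := 7 * _; have K0 : 0 < K by rewrite muln_gt0 expn_gt0 muln_gt0 c0.
elim: P s u X => [|P IH] s u X hP.
  exists (fun=> u); split=> //; first by move=> i; lia.
  suff -> : X = set0 by rewrite sub0set.
  apply/eqP; rewrite -cards_eq0; move: hP; rewrite muln0 leqn0 muln_eq0.
  by rewrite gtn_eqF // muln_gt0 K0 expn_gt0 E0.
have e1 : s + P.+1 * (2 * n) = s + 2 * n + P * (2 * n) by rewrite mulSn addnA.
have ext (p : nat -> V) (Y : {set V}) : traj A s (s + 2 * n) p -> p s = u ->
    X \subset vis p s (s + 2 * n) :|: Y ->
    K * E ^ 2 * #|Y| <= n ^ 2 * P ^ 3 ->
    exists p, [/\ traj A s (s + P.+1 * (2 * n)) p, p s = u &
      X \subset vis p s (s + P.+1 * (2 * n))].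
  move=> hp pu sX hY.
  have [p' [hp' pu' vp']] := IH (s + 2 * n) (p (s + 2 * n)) Y hY.
  exists (tcat (s + 2 * n) p p'); rewrite e1; split.
  - by apply: traj_cat hp hp' _.
  - by rewrite tcat_l ?leq_addr.
  - apply: subset_trans sX _; rewrite subUset vis_catl ?leq_addr //=.
    by apply: subset_trans vp' _; apply: vis_catr; rewrite ?leq_addr.
case: (leqP (K * E ^ 2 * #|X|) (n ^ 2 * P ^ 3)) => lo.
  apply: (ext (fun=> u) X) => //; first by move=> i; left.
  exact: subsetUr.
have X0 : 0 < #|X| by rewrite lt0n; apply: contraTneq lo => ->; rewrite muln0.
(* Take the largest [h] that one phase can afford; the failure of [h.+1] is what [phase_arith]
   uses. *)
pose Ph h := c * h ^ 3 * E <= #|X| * n.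
have exP : exists h, Ph h by exists 0; rewrite /Ph muln0.
have bP h : Ph h -> h <= #|X| * n.
  apply: leq_trans; apply: (@leq_trans (h ^ 3)).
    by case: h => // h; rewrite -{1}[h.+1]expn1 leq_pexp2l.
  by rewrite -mulnA mulnCA leq_pmulr // muln_gt0 c0.
have [h Phh maxh] := ex_maxnP exP bP.
have nPh : #|X| * n < c * h.+1 ^ 3 * E.
  by rewrite ltnNge; apply/negP => /maxh; rewrite ltnn.
have big : 33 * 161 * h ^ 3 * E <= #|X| * n by rewrite -ec.
have [p [hp pu hv]] := phase_from s u X0 nE big.
move: hv; set W := _ :&: X => hv.
apply: (ext p (X :\: W) hp pu).
  by apply/subsetP => a aX; rewrite !inE aX andbT; case: (a \in vis _ _ _).
have -> : #|X :\: W| = #|X| - #|W| by rewrite cardsDS // subsetIr.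
apply: (phase_arith (h := h)) => //; rewrite ?n0 ?lo //.
  by apply: leq_trans hv; rewrite leq_maxl.
by apply: leq_trans hv; rewrite leq_maxr.
Qed.

End Exploration.

(** * Trajectories as temporal walks *)

Section TemporalWalkOfTrajectory.
Variables (V : finType) (T : nat) (G : tgraph V T.+1) (p : nat -> V).

(** Waiting leaves no step, since a temporal walk lists only traversed edges. *)
Fixpoint steps (s k : nat) : seq (tstep V T.+1) :=
  if k is k'.+1 then
    if p s == p s.+1 then steps s.+1 k'
    else ((p s, p s.+1), inord s) :: steps s.+1 k'
  else [::].

Lemma stepsP s k : s + k <= T.+1 ->
  traj (fun t => adj (G (inord t))) s (s + k) p ->
  [/\ temporal_walk G (p s) (steps s k),
      forall x, x \in steps s k -> s <= nat_of_ord x.2 < s + k &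
      forall a, a \in vis p s (s + k) -> a \in visited (p s) (steps s k)].
Proof.
elim: k s => [|k IH] s sT hp.
  split=> // [|a /visP[i si <-]]; first by rewrite /temporal_walk /= eqxx.
  by rewrite (_ : i = s) ?mem_head //; lia.
have [] := IH s.+1; [by lia|by move=> i hi; apply: hp; lia|].
move=> /and3P[w1 w2 /eqP w3] tm vs.
have os : nat_of_ord (inord s : 'I_T.+1) = s by rewrite inordK //; lia.
have vis1 a : a \in vis p s (s + k.+1) -> a = p s \/ a \in vis p s.+1 (s.+1 + k).
  case/visP=> i hi <-; have [->|ne] := eqVneq i s; first by left.
  by right; apply/visP; exists i => //; lia.
have tm1 (x : tstep V T.+1) : x \in steps s.+1 k -> s <= nat_of_ord x.2 < s + k.+1.
  by move=> /tm; rewrite addSnnS => /andP[/ltnW -> ->].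
rewrite /=; case: (eqVneq (p s) (p s.+1)) => [ps|ps].
  split=> //; first by rewrite ps /temporal_walk w1 w2 w3 eqxx.
  move=> a /vis1[->|/vs]; first exact: mem_head.
  by rewrite /visited ps.
have As : adj (G (inord s)) (p s) (p s.+1).
  by case: (hp s) => //; [lia|move=> es; rewrite es eqxx in ps].
split.
- rewrite /temporal_walk /= As w1 eqxx andbT /=.
  case: (steps s.+1 k) w2 w3 tm => [|y w] //= -> w3 /(_ y (mem_head _ _)).
  by rewrite -w3 eqxx os => /andP[-> _].
- move=> x; rewrite inE => /orP[/eqP->|]; last exact: tm1.
  by rewrite /= os leqnn -addSnnS leq_addr.
- move=> a /vis1[->|/vs]; first exact: mem_head.
  by rewrite /visited /= !inE => ->; rewrite orbT.
Qed.

End TemporalWalkOfTrajectory.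

(** * The degree sum and the exploration bound *)

Lemma card_le_sum_degree (V : finType) (G : sgraph V) :
  connected_graph G -> 1 < #|V| -> #|V| <= \sum_v degree G v.
Proof.
move=> conn V2; rewrite -sum1_card; apply: leq_sum => v _.
have [u uv] : exists u, u \notin [set v].
  have : 0 < #|~: [set v]| by rewrite cardsCs setCK cards1 subn_gt0.
  by case/card_gt0P=> u; rewrite inE; exists u.
have [k [w [/set1P -> _ vw]]] := connect_cross (conn v u) (set11 v) uv.
by apply/card_gt0P; exists w; rewrite inE.
Qed.

(** Take the least [P] satisfying the first bound. Its predecessor violates it and, for [P >= 2], is
    at least [P / 2], whence the factor [8 = 2 ^ 3]. *)
Lemma min_cube_root (K n E : nat) : 0 < K -> 0 < n <= E ->
  exists2 P, K * E ^ 2 * n <= n ^ 2 * P ^ 3 & n ^ 2 * P ^ 3 <= 8 * (K * E ^ 2 * n).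
Proof.
move=> K0 /andP[n0 nE].
have ex : exists P, K * E ^ 2 * n <= n ^ 2 * P ^ 3.
  exists (K * E ^ 2 * n); set P := K * _ * _.
  apply: (@leq_trans (P ^ 3)); last by rewrite leq_pmull // expn_gt0 n0.
  by case: P => // P; rewrite -{1}[P.+1]expn1 leq_pexp2l.
have [P hP minP] := ex_minnP ex; exists P => //.
have E0 : 0 < E by apply: leq_trans nE.
case: P hP minP => [|P] hP minP; first by rewrite muln0.
have lt : n ^ 2 * P ^ 3 < K * E ^ 2 * n.
  by rewrite ltnNge; apply/negP => /minP; rewrite ltnn.
have [->|P0] := posnP P.
  rewrite muln1; apply: (@leq_trans (E ^ 2 * n)); last first.
    by rewrite mulnA leq_mul2r mulnA leq_pmull ?muln_gt0 ?K0 ?orbT.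
  by apply: (@leq_trans (E ^ 2)); [rewrite leq_exp2r|rewrite leq_pmulr].
apply: (@leq_trans (n ^ 2 * (8 * P ^ 3))).
  rewrite leq_mul2l; apply/orP; right.
  have -> : 8 * P ^ 3 = (2 * P) ^ 3 by rewrite expnMn.
  by rewrite leq_exp2r //; lia.
by rewrite mulnCA leq_mul2l ltnW.
Qed.

Local Open Scope ring_scope.

Lemma powR_half_sqr (R : realType) (x : R) (k : nat) :
  0 <= x -> (x `^ (k%:R / 2)) ^+ 2 = x ^+ k.
Proof.
by move=> x0; rewrite -powR_mulrn ?powR_ge0 // -powRrM divfK ?powR_mulrn.
Qed.

Lemma sqr_mul_le_cube (R : realType) (a d : R) :
  0 <= a -> 0 <= d -> a ^+ 2 * d <= (a + d) ^+ 3.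
Proof.
move=> a0 d0.
have a2d : 0 <= a ^+ 2 * d by rewrite mulr_ge0 ?exprn_ge0.
have ad2 : 0 <= a * d ^+ 2 by rewrite mulr_ge0 ?exprn_ge0.
have a3 : 0 <= a ^+ 3 by rewrite exprn_ge0.
have d3 : 0 <= d ^+ 3 by rewrite exprn_ge0.
by rewrite (_ : (a + d) ^+ 3 = a ^+ 3 + 3 * (a ^+ 2 * d) + 3 * (a * d ^+ 2) + d ^+ 3);
  [lra|ring].
Qed.

Lemma exploration_bound_gt0 (R : realType) (n r b : nat) (D : R) :
  (0 < n)%N -> (0 < r)%N -> 0 < exploration_bound n r b D.
Proof.
move=> n0 r0; apply: ltr_wpDl; last by rewrite divr_gt0 ?exprn_gt0 ?ltr0n.
by do 4![apply: mulr_ge0; rewrite ?powR_ge0 ?exprn_ge0 ?ler0n //].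
Qed.

(** In the square of the first summand times the second, the powers of [r] cancel and [n * E ^ 3]
    remains beside the logarithm, with [n <= E]; [sqr_mul_le_cube] is the weak AM-GM needed. *)
Lemma exploration_bound_cube (R : realType) (n r b E : nat) :
  (0 < n <= E)%N -> (2 <= r)%N -> (1 <= b)%N ->
  (ln 2) ^+ 3 * (n ^ 2 * E ^ 2)%:R <=
    exploration_bound n r b (E%:R / n%:R : R) ^+ 3.
Proof.
move=> /andP[n0 nE] r2 b1; rewrite /exploration_bound.
set D : R := E%:R / n%:R.
have nR : (0 : R) < n%:R by rewrite ltr0n.
have rR : (0 : R) < r%:R by rewrite ltr0n; apply: leq_trans r2.
have D0 : 0 <= D by rewrite divr_ge0.
have l2 : (0 : R) < ln 2 by rewrite ln_gt0 // ltr1n.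
have lr : ln 2 <= ln r%:R :> R by rewrite ler_ln ?posrE // ler_nat.
have lr0 : 0 <= ln r%:R :> R by apply: le_trans lr; apply: ltW.
(* The first summand with [b ^ 3] lowered to 1 and [ln r] to [ln 2]. *)
pose a := n%:R * (r%:R `^ (1 / 2)) * (D `^ (3 / 2)) * ((ln 2) `^ (3 / 2)).
have a0 : 0 <= a by rewrite !mulr_ge0 ?powR_ge0.
set a' := n%:R * _ * _ * _ * _; set d := n%:R ^+ 2 / r%:R.
have d0 : 0 <= d by rewrite divr_ge0 ?exprn_ge0 ?ltW.
have aa' : a <= a'.
  have -> : a' = b%:R ^+ 3 *
      (n%:R * (r%:R `^ (1 / 2)) * (D `^ (3 / 2)) * ((ln r%:R) `^ (3 / 2))).
    by rewrite /a'; ring.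
  rewrite -[a]mul1r; apply: ler_pM => //; first by rewrite exprn_ege1 // ler1n.
  rewrite /a ler_wpM2l ?mulr_ge0 ?powR_ge0 //.
  by rewrite ge0_ler_powR ?nnegrE ?divr_ge0 // ltW.
have cube : a ^+ 2 * d <= (a' + d) ^+ 3.
  apply: (@le_trans _ _ ((a + d) ^+ 3)); last first.
    by rewrite lerXn2r ?nnegrE ?addr_ge0 // ?lerD2r // (le_trans a0).
  exact: sqr_mul_le_cube.
apply: le_trans cube.
have -> : a ^+ 2 * d = (ln 2) ^+ 3 * (n%:R * E%:R ^+ 3).
  have s1 : (r%:R `^ (1 / 2)) ^+ 2 = r%:R :> R by apply: (powR_half_sqr 1); apply: ltW.
  have s2 : (D `^ (3 / 2)) ^+ 2 = D ^+ 3 by apply: (powR_half_sqr 3).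
  have s3 : ((ln 2) `^ (3 / 2)) ^+ 2 = (ln 2) ^+ 3 :> R.
    by apply: (powR_half_sqr 3); apply: ltW.
  have key (x1 x2 x3 : R) : x1 ^+ 2 = r%:R -> x2 ^+ 2 = D ^+ 3 ->
      x3 ^+ 2 = (ln 2) ^+ 3 ->
      (n%:R * x1 * x2 * x3) ^+ 2 * d = (ln 2) ^+ 3 * (n%:R * E%:R ^+ 3).
    move=> e1 e2 e3.
    have -> : (n%:R * x1 * x2 * x3) ^+ 2 * d =
              n%:R ^+ 2 * x1 ^+ 2 * x2 ^+ 2 * x3 ^+ 2 * d by ring.
    by rewrite e1 e2 e3 /d /D; field; rewrite !gt_eqF.
  exact: key s1 s2 s3.
apply: ler_wpM2l; first by rewrite exprn_ge0 ?ltW.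
rewrite -natrX -natrM ler_nat expnSr expn1 [(E ^ 3)%N]expnSr -mulnA leq_mul2l.
by apply/orP; right; rewrite mulnC leq_mul2l nE orbT.
Qed.

Theorem theorem3 (R : realType) (c : R) (hc : 0 < c) :
  exists2 C : R, 0 < C &
    forall (V : finType) (T : nat) (G : tgraph V T) (r b : nat),
      always_connected G ->
      (2 <= r)%N -> (1 <= b)%N ->
      (exists S : {set V}, strict_division c (underlying G) r b S) ->
      let f := exploration_bound #|V| r b (average_degree R (underlying G)) in
      C * f <= T%:R ->
      forall start : 'I_b -> V,
        explorable_within G start (Num.ceil (C * f)).
Proof.
have [K K0 expl] : exists2 K, (0 < K)%N &
  forall (V : finType) (A : nat -> rel V) (e : rel V), (forall t, symmetric (A t)) ->
  (forall t x y, connect (A t) x y) -> (forall t x y, A t x y -> e x y) ->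
  forall P s u (X : {set V}), (#|V| <= \sum_w #|[set k | e w k]|)%N ->
  (K * (\sum_w #|[set k | e w k]|) ^ 2 * #|X| <= #|V| ^ 2 * P ^ 3)%N ->
  exists p, [/\ traj A s (s + P * (2 * #|V|)) p, p s = u &
    X \subset vis p s (s + P * (2 * #|V|))].
  exists (7 * (56 * (33 * 161)) ^ 2)%N; first by rewrite muln_gt0 expn_gt0.
  by move=> V A e sA cA eA P s u X; apply: explore.
have l2 : (0 : R) < ln 2 by rewrite ln_gt0 // ltr1n.
(* [64 = 8 * 8]: one 8 is the cube of the 2 in [2 * #|V|], the other comes from [min_cube_root]. The
   summand 1 ensures [C <= C ^ 3]. *)
pose C : R := 1 + 64 * K%:R / (ln 2) ^+ 3.
have C1 : 1 <= C.
  by rewrite lerDl; apply: divr_ge0; [apply: mulr_ge0|rewrite exprn_ge0 // ltW].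
have C0 : 0 < C by apply: lt_le_trans C1.
exists C => // V T G r b conn r2 b1 _ f fT start.
have i0 : 'I_b by exists 0%N.
have n0 : (0 < #|V|)%N by apply/card_gt0P; exists (start i0).
(* A single vertex has degree sum 0, so [nE] would fail there. *)
have [n1|n2] := leqP #|V| 1.
  exists (fun=> [::]); split=> // [i|v]; first by rewrite /temporal_walk /= eqxx.
  exists i0; rewrite /visited inE; apply/eqP.
  by move/card_le1_eqP: n1; apply.
have f_gt0 : 0 < f by apply: exploration_bound_gt0 => //; apply: leq_trans r2.
have f0 := ltW f_gt0.
case: T G conn @f fT f_gt0 f0 => [|T] G conn f fT f_gt0 f0.
  by move: fT; rewrite leNgt mulr_gt0.
(* [inord] sends times beyond the last snapshot to index 0, so [A t] is connected for every [t]. *)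
pose A t := adj (G (inord t)).
pose e := adj (underlying G).
have A_sym t : symmetric (A t) by apply: adj_sym.
have A_conn t x y : connect (A t) x y by apply: conn.
have A_sub t x y : A t x y -> e x y by move=> xy; apply/existsP; exists (inord t).
pose E := (\sum_w #|[set k | e w k]|)%N.
have nE : (#|V| <= E)%N.
  apply: (@leq_trans (\sum_v degree (G ord0) v)).
    exact: card_le_sum_degree.
  apply: leq_sum => v _; apply: subset_leq_card; apply/subsetP => w.
  by rewrite !inE => vw; apply/existsP; exists ord0.
have nE' : (0 < #|V| <= E)%N by rewrite n0.
have [P loP upP] := min_cube_root K0 nE'.
have Pf : (P * (2 * #|V|))%:R <= C * f.
  rewrite -(@ler_pXn2r _ 3) ?nnegrE ?mulr_ge0 ?(ltW C0) //.
  apply: (@le_trans _ _ (64 * K%:R * (#|V| ^ 2 * E ^ 2)%:R)).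
    rewrite -natrX -!natrM ler_nat.
    have -> : ((P * (2 * #|V|)) ^ 3 = 8 * #|V| * (#|V| ^ 2 * P ^ 3))%N.
      by rewrite !expnS !expn0; lia.
    apply: leq_trans (leq_mul (leqnn _) upP) _.
    by rewrite leq_eqVlt; apply/orP; left; apply/eqP; rewrite !expnS !expn0; lia.
  have := exploration_bound_cube R nE' r2 b1.
  rewrite -[exploration_bound _ _ _ _]/f => cube.
  rewrite exprMn; apply: (@le_trans _ _ (C * f ^+ 3)); last first.
    rewrite ler_wpM2r ?exprn_ge0 // -[X in X <= _]expr1.
    exact: ler_weXn2l.
  apply: (@le_trans _ _ (64 * K%:R / (ln 2) ^+ 3 * f ^+ 3)); last first.
    by rewrite ler_wpM2r ?exprn_ge0 // lerDr.
  rewrite [X in _ <= X]mulrAC ler_pdivlMr ?exprn_gt0 // -[X in X <= _]mulrA.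
  by apply: ler_wpM2l; [apply: mulr_ge0|rewrite mulrC].
have [|p [hp pu vp]] := expl V A e A_sym A_conn A_sub P 0%N (start i0) [set: V] nE.
  by rewrite cardsT.
have PT : (0 + P * (2 * #|V|) <= T.+1)%N by rewrite -(ler_nat R); apply: le_trans fT.
have [w1 w2 w3] := stepsP PT hp.
(* Agent [i0] explores; the others wait at their start vertices. *)
exists (fun i => if i == i0 then steps T p 0 (P * (2 * #|V|)) else [::]); split.
- by move=> i; case: eqP => [->|_]; [rewrite -pu|rewrite /temporal_walk /= eqxx].
- move=> i x; case: eqP => // _ /w2 /= xP.
  rewrite -(ler_int R); apply: le_trans (ceil_ge _); apply: le_trans Pf.
  by rewrite ler_nat.
- move=> v; exists i0; rewrite eqxx -pu; apply: w3.
  by apply: (subsetP vp); rewrite inE.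
Qed.
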